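(* Let $(X,d)$ be a metric space and $(Y,\varrho)$ be a linear metric space with a translation-invariant metric. Let $a,b,r,\kappa,\hat\kappa,\ell$ be positive constants such that $\kappa\ell<1$ and $\hat\kappa>\kappa/(1-\kappa\ell)$, let $c\in[0,\infty]$, let $(\bar x,\bar z,\bar w)\in X\times Y\times Y$, and let $F,G:X\rightrightarrows Y$ be set-valued mappings with $\bar z\in F(\bar x)$ and $\bar w\in G(\bar x)$. Put $$\alpha:=a+\hat\kappa(b+r),\qquad\beta:=c+\alpha\ell,\qquad\delta:=\beta+b+r.$$ Assume that the sets $\operatorname{gph}F\cap(B_X[\bar x,\alpha]\times B_Y[\bar z,\delta])$ and $\operatorname{gph}G\cap(B_X[\bar x,\alpha]\times B_Y[\bar w,\beta])$ are complete and that the following conditions hold: (i) $F$ is $B_Y[\bar z,\delta]$-restrictedly regular on $B_X(\bar x,\alpha)\times B_Y(\bar z,\delta)$ with the constant $\kappa$; (ii) $G$ has Aubin property on $B_X(\bar x,\alpha)\times B_Y(\bar w,\beta)$ with the constant $\ell$; (iii) for each $x\in B_X(\bar x,a)$ and each $v\in(F+G)(x)\cap B_Y[\bar z+\bar w,b+r]$ there is a $w\in G(x)\cap B_Y(\bar w,a\ell+c)$ such that $v\in F(x)+w$. Then for each $\bar q\in B_Y[\bar w,\min\{r,b\}]$ the sum $F+G$ is $B_Y[\bar z+\bar q,r]$-restrictedly regular on $B_X(\bar x,a)\times B_Y(\bar z+\bar q,b)$ with the constant $\hat\kappa$.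
   Context: Vector spaces are real. $B_X[x,r]$ and $B_X(x,r)$ denote the closed and the open ball with center $x$ and radius $r$; for $r=\infty$ both equal the whole space $X$. A closed ball of radius $0$ is the singleton of its center. Completeness of subsets of $X\times Y$ is with respect to a standard product metric, e.g. $\max\{d,\varrho\}$. For $F,G:X\rightrightarrows Y$: $\operatorname{gph}F=\{(x,y): y\in F(x)\}$, $F^{-1}(y)=\{x: y\in F(x)\}$, $(F+G)(x)=\{z+w: z\in F(x),\,w\in G(x)\}$. Convention: $\inf\emptyset=\infty$, so the distance of a point to the empty set is $\infty$. For non-empty $V\subset Y$, $W\subset X\times Y$ and $\kappa>0$, a mapping $F:X\rightrightarrows Y$ is $V$-restrictedly regular on $W$ with the constant $\kappa$ if $\operatorname{dist}(x,F^{-1}(y))\le\kappa\operatorname{dist}(y,F(x)\cap V)$ for each $(x,y)\in W$. A mapping $G:X\rightrightarrows Y$ has Aubin property on $U\times V\subset X\times Y$ with the constant $\ell$ if $G(x)\cap V\subset G(u)+B_Y[0,\ell\,d(x,u)]$ for each $x,u\in U$. *)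

(* Defs.v *)
From HB Require Import structures.
From mathcomp Require Import all_boot all_order all_algebra.
From mathcomp Require Import all_classical all_reals.
From mathcomp Require Import ereal topology.

Set Implicit Arguments.
Unset Strict Implicit.
Unset Printing Implicit Defensive.

Import Order.TTheory GRing.Theory Num.Theory.
Import numFieldTopology.Exports.

Local Open Scope classical_set_scope.
Local Open Scope ring_scope.

(* The library's topologicalLmodType cannot be joined with metricType: its file
   also declares PseudoMetricNormedZmod, and Hierarchy Builder then rejects a
   second join of PseudoMetric and Zmodule. Hence the two continuity axioms of
   topologicalLmodType are repeated here, and files declaring normed modules
   are not imported. *)
HB.mixin Record isLinearMetric (K : numFieldType) M
    & Metric K M & GRing.Lmodule K M := {
  add_continuous : continuous (fun x : M * M => x.1 + x.2) ;
  scale_continuous : continuous (fun z : K^o * M => z.1 *: z.2)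
}.

#[short(type="linearMetricType")]
HB.structure Definition LinearMetric (K : numFieldType) :=
  {M of Metric K M & GRing.Lmodule K M & isLinearMetric K M}.

Definition translation_invariant (R : realType) (Y : linearMetricType R) :=
  forall x y z : Y, mdist (x + z) (y + z) = mdist x y.

(* Balls with extended radius: both are setT for r = +oo. The library's
   closed_ball is the closure of an open ball, which is smaller in general
   and is empty for radius 0. *)
Definition oball (R : realType) (T : metricType R) (x : T) (r : \bar R) :
  set T := [set y | ((mdist x y)%:E < r)%E].

Definition cball (R : realType) (T : metricType R) (x : T) (r : \bar R) :
  set T := [set y | ((mdist x y)%:E <= r)%E].

Definition dist (R : realType) (T : metricType R) (x : T) (A : set T) :
  \bar R := ereal_inf [set (mdist x y)%:E | y in A].

(* On a product X * Y of metric spaces the library's uniformity is that of the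
   metric max(d, rho). *)
Definition complete_subset (T : uniformType) (A : set T) :=
  forall u : nat -> T, (forall n, A (u n)) -> cauchy (u @ \oo) ->
    exists2 p, A p & u @ \oo --> p.

Definition gph (X Y : Type) (F : X -> set Y) : set (X * Y) :=
  [set p | F p.1 p.2].

Definition sv_inv (X Y : Type) (F : X -> set Y) (y : Y) : set X :=
  [set x | F x y].

Definition set_add (Y : zmodType) (A B : set Y) : set Y :=
  [set z + w | z in A & w in B].

Definition sv_add (X : Type) (Y : zmodType) (F G : X -> set Y) (x : X) :
  set Y := set_add (F x) (G x).

(* V and W are understood to be non-empty; this is not part of the property. *)
Definition restrictedly_regular (R : realType) (X Y : metricType R)
    (F : X -> set Y) (V : set Y) (W : set (X * Y)) (kappa : R) :=
  forall x y, W (x, y) ->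
    (dist x (sv_inv F y) <= kappa%:E * dist y (F x `&` V))%E.

Definition aubin_property (R : realType) (X : metricType R)
    (Y : linearMetricType R) (G : X -> set Y) (U : set X) (V : set Y)
    (l : R) :=
  forall x u, U x -> U u ->
    G x `&` V `<=` set_add (G u) (cball (0 : Y) (l * mdist x u)%:E).

(* Main.v *)
Require Import Defs.
From HB Require Import structures.
From mathcomp Require Import all_boot all_order all_algebra.
From mathcomp Require Import all_classical all_reals.
From mathcomp Require Import ereal topology.
From mathcomp Require Import ring lra.

Set Implicit Arguments.
Unset Strict Implicit.
Unset Printing Implicit Defensive.

Import Order.TTheory GRing.Theory Num.Theory.
Import numFieldTopology.Exports.

Local Open Scope classical_set_scope.
Local Open Scope ring_scope.

(* The proof is a Lyusternik-Graves iteration. From [z] in [F x] and [w] in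
   [G x], regularity of [F] gives a point [x'] with [y - w] in [F x'] at distance
   at most [k * d(y, z + w)], where [k > kappa], and the Aubin property of [G]
   gives [w'] in [G x'] with [d(w, w') <= l * d(x, x')]. By translation
   invariance the new residual [d(y, (y - w) + w')] is [d(w, w')], so residuals
   decrease geometrically with ratio [k * l < 1]; the choice
   [k = khat / (1 + l * khat)] makes the total displacement of [x] at most [khat]
   times the initial residual. Condition (iii) supplies the starting pair, and
   completeness of the two graphs the limit, whose residual is zero. *)

(** * Geometric decay and Cauchy sequences *)

Lemma exists_exprn_lt (R : archiRealFieldType) (q e : R) :
  0 <= q < 1 -> 0 < e -> exists n, q ^+ n < e.
Proof.
move=> /andP[q0 q1] e0; pose h := 1 - q; have h0 : 0 < h by rewrite subr_gt0.
have bernoulli n : q ^+ n * (1 + n%:R * h) <= 1.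
  elim: n => [|n IH]; first by rewrite mul0r addr0 mulr1.
  apply: le_trans IH; rewrite exprSr -mulrA ler_wpM2l ?exprn_ge0//.
  rewrite -natr1 /h.
  have := mulr_ge0 (ler0n R n) (sqr_ge0 (1 - q)); have := sqr_ge0 (1 - q); nra.
have [n en] : exists n, e^-1 < 1 + n%:R * h.
  exists (Num.bound (e^-1 / h)).
  have eh0 : 0 <= e^-1 / h by rewrite divr_ge0 ?invr_ge0 ?ltW.
  have := archi_boundP eh0.
  by rewrite ltr_pdivrMr// => /lt_trans; apply; rewrite ltrDr.
exists n; have n0 : 0 < 1 + n%:R * h by apply: lt_trans en; rewrite invr_gt0.
rewrite -(ltr_pM2r n0); apply: le_lt_trans (bernoulli n) _.
by rewrite mulrC -ltr_pdivrMr// mul1r.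
Qed.

Lemma cauchy_geometric (R : realType) (T : pseudoMetricType R) (u : nat -> T)
    (C q : R) : 0 < C -> 0 < q < 1 ->
  (forall n, ball (u n) (C * q ^+ n) (u n.+1)) -> cauchy (u @ \oo).
Proof.
move=> C0 /andP[q0 q1] hu; apply: cauchy_exP => e e0.
have h0 : 0 < 1 - q by rewrite subr_gt0.
have [||N hN] := @exists_exprn_lt R q (e * (1 - q) / (2 * C)).
- by rewrite (ltW q0).
- by rewrite divr_gt0 ?mulr_gt0// mulr_gt0.
exists (u N); exists N => // n /= /subnKC <-.
(* The first [k] steps sum to [C * q ^+ N * (1 - q ^+ k) / (1 - q)]. The [2] in place of [1] keeps
   the radius positive at [k = 0], as [ballxx] requires; it accounts for the factor 2 in the choice
   of [N]. *)
have bk k : ball (u N) (C * q ^+ N * (2 - q ^+ k) / (1 - q)) (u (N + k)%N).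
  elim: k => [|k IH].
    rewrite addn0; apply: ballxx.
    by rewrite divr_gt0// !mulr_gt0// ?exprn_gt0// expr0; lra.
  rewrite addnS; have -> : C * q ^+ N * (2 - q ^+ k.+1) / (1 - q) =
     C * q ^+ N * (2 - q ^+ k) / (1 - q) + C * q ^+ (N + k).
    by rewrite exprD exprS; field; rewrite gt_eqF.
  exact: ball_triangle IH (hu _).
apply: le_ball (bk (n - N)%N); rewrite ler_pdivrMr//.
rewrite ltr_pdivlMr ?mulr_gt0// in hN; apply: le_trans (ltW hN).
have := exprn_gt0 (n - N) q0; have := mulr_gt0 C0 (exprn_gt0 N q0); nra.
Qed.

(** * Translation-invariant metrics *)

Section translation.
Context (R : realType) (Y : linearMetricType R).
Hypothesis Y_inv : translation_invariant Y.
Implicit Types u w x y z : Y.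

Lemma mdistDl z x y : mdist (z + x) (z + y) = mdist x y.
Proof. by rewrite ![z + _]addrC Y_inv. Qed.

Lemma mdistBr z u w : mdist z (u - w) = mdist (z + w) u.
Proof. by rewrite -(Y_inv _ _ w) subrK. Qed.

End translation.

(** * The iteration and its limit *)

Lemma cvg_prod_mdist (R : realType) (X Y : metricType R) (u : nat -> X * Y)
    (p : X * Y) (e : R) : u @ \oo --> p -> 0 < e ->
  \forall n \near \oo, mdist p.1 (u n).1 < e /\ mdist p.2 (u n).2 < e.
Proof.
move=> up e0; apply: filterS (cvg_ball up e0) => n [] /=.
by rewrite !ballEmdist.
Qed.

(* The function [e] below is the residual [mdist y (z + w)]; a step of length at
   most [k * e] leaves a residual at most [l * k * e]. As [k + l * k * K = K],
   the quantity [mdist x0 x + K * e] does not increase along the iteration. *)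
Lemma coupled_iteration (R : realType) (X : metricType R)
    (Y : linearMetricType R) (Y_inv : translation_invariant Y)
    (A B : set (X * Y)) (k l K : R) (x0 : X) (y z0 w0 : Y) :
  let e (z w : Y) := mdist y (z + w) in
  0 < k -> 0 < l -> 0 < K -> k + l * k * K = K ->
  complete_subset A -> complete_subset B -> A (x0, z0) -> B (x0, w0) ->
  (forall x z w, A (x, z) -> B (x, w) ->
     mdist x0 x + K * e z w <= K * e z0 w0 ->
     mdist w0 w + l * K * e z w <= l * K * e z0 w0 ->
     exists x' w', [/\ A (x', y - w), B (x', w'),
       mdist x x' <= k * e z w & mdist w w' <= l * mdist x x']) ->
  exists p z w, [/\ A (p, z), B (p, w), z + w = y & mdist x0 p <= K * e z0 w0].
Proof.
move=> e k0 l0 K0 kK cA cB A0 B0 step.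
set t := e z0 w0 in step *; have t0 : 0 <= t by exact: mdist_ge0.
pose q := l * k; have q0 : 0 < q by rewrite mulr_gt0.
have q1 : q < 1 by rewrite -(ltr_pM2r K0) mul1r -{2}kK ltrDr.
(* The two budgets bound the drift of [x] and of [w] from the start, which is what [step] asks for
   before it can be applied again. *)
pose I (s : X * Y * Y) := let: (x, z, w) := s in
  [/\ A (x, z), B (x, w), mdist x0 x + K * e z w <= K * t
    & mdist w0 w + l * K * e z w <= l * K * t].
pose next (s s' : X * Y * Y) :=
  let: (x, z, w) := s in let: (x', z', w') := s' in
  [/\ z' = y - w, mdist x x' <= k * e z w & mdist w w' <= l * mdist x x'].
have eS w w' : e (y - w) w' = mdist w w'.
  by rewrite /e addrAC -addrA -{1}[y]addr0 mdistDl// -(Y_inv _ _ w) subrK add0r.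
have nextP (s : {s | I s}) : {s' : {s | I s} | next (sval s) (sval s')}.
  apply: cid; case: s => [[[x z] w] /= [Axz Bxw bx bw]].
  have [x' [w' [A' B' dx dw]]] := step _ _ _ Axz Bxw bx bw.
  (* Since [K = (1 + K * l) * k], the old residual pays for the step and for [K] times the new
     residual. *)
  have budget : mdist x x' + K * mdist w w' <= K * e z w.
    have -> : K * e z w = (1 + K * l) * (k * e z w) by rewrite -{1}kK; ring.
    apply: le_trans (ler_wpM2l _ dx); last by rewrite ltW// addr_gt0 ?mulr_gt0.
    have := ler_wpM2l (ltW K0) dw; lra.
  have I' : I (x', y - w, w').
    split => //; rewrite eS.
    - apply: le_trans bx; have := metric_triangle x0 x x'; lra.
    - apply: le_trans bw; have := metric_triangle w0 w w'.
      have := ler_wpM2l (ltW l0) budget; lra.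
  by exists (exist _ _ I').
have I0 : I (x0, z0, w0) by split; rewrite // mdistxx add0r.
have [f [f0 fS]] := dependent_choice nextP (exist _ _ I0).
pose x n := (sval (f n)).1.1; pose z n := (sval (f n)).1.2.
pose w n := (sval (f n)).2.
have fE n : sval (f n) = (x n, z n, w n).
  by rewrite /x /z /w -!surjective_pairing.
have fI n : I (x n, z n, w n) by rewrite -fE; exact: (svalP (f n)).
have {}fS n : next (x n, z n, w n) (x n.+1, z n.+1, w n.+1) by rewrite -!fE.
have e_le n : e (z n) (w n) <= t * q ^+ n.
  elim: n => [|n IH]; first by rewrite /z /w f0 /= expr0 mulr1.
  have [-> dx dw] := fS n; rewrite eS; apply: le_trans dw _.
  rewrite exprS mulrCA -mulrA; have := ler_wpM2l (ltW q0) IH.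
  rewrite /q; have := ler_wpM2l (ltW l0) dx; lra.
(* The factor [1 + k + q] dominates the step factors [k], [1], [q] of [x], [z], [w]; [t + 1] keeps
   the bounds strict even when [t = 0]. *)
pose C := (1 + k + q) * (t + 1).
have C0 : 0 < C by rewrite mulr_gt0; lra.
have ball_le (T : metricType R) (u v : T) n m :
    0 <= m -> m <= 1 + k + q -> mdist u v <= m * (t * q ^+ n) ->
    ball u (C * q ^+ n) v.
  move=> m0 mC uv; rewrite ballEmdist /=; apply: le_lt_trans uv _.
  rewrite mulrA ltr_pM2r ?exprn_gt0 // /C.
  have : m * t <= (1 + k + q) * t by rewrite ler_wpM2r.
  lra.
have xx n : ball (x n) (C * q ^+ n) (x n.+1).
  have [_ dx _] := fS n; apply: (ball_le _ _ _ n k); [lra|lra|].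
  by apply: le_trans dx _; rewrite ler_pM2l.
have zz n : ball (z n) (C * q ^+ n) (z n.+1).
  have [-> _ _] := fS n; apply: (ball_le _ _ _ n 1); [lra|lra|].
  by rewrite mdistBr// metric_sym mul1r; exact: e_le.
have ww n : ball (w n) (C * q ^+ n) (w n.+1).
  have [_ dx dw] := fS n; apply: (ball_le _ _ _ n q); [lra|lra|].
  apply: le_trans dw _; rewrite -mulrA ler_pM2l//.
  by apply: le_trans dx _; rewrite ler_pM2l.
have q01 : 0 < q < 1 by rewrite q0.
have [||[p zp] Ap cvA] := cA (fun n => (x n, z n)).
- by move=> n; have [] := fI n.
- by apply: (cauchy_geometric C0 q01) => n; split; [exact: xx|exact: zz].
have [||[p' wp] Bp cvB] := cB (fun n => (x n, w n)).
- by move=> n; have [] := fI n.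
- by apply: (cauchy_geometric C0 q01) => n; split; [exact: xx|exact: ww].
(* Each complete graph yields its own limit of [x]; a common index close to both limits serves to
   identify them and to pass to the limit in the residual. *)
have approx eps : 0 < eps -> exists n, [/\ mdist p (x n) < eps,
    mdist p' (x n) < eps, mdist zp (z n) < eps, mdist wp (w n) < eps
    & e (z n) (w n) < eps].
  move=> eps0; have [||N hN] := @exists_exprn_lt R q (eps / (t + 1)).
  - by rewrite (ltW q0).
  - by rewrite divr_gt0//; lra.
  near \oo => n.
  have [px zz'] : mdist p (x n) < eps /\ mdist zp (z n) < eps.
    by near: n; exact: cvg_prod_mdist cvA eps0.
  have [px' ww'] : mdist p' (x n) < eps /\ mdist wp (w n) < eps.
    by near: n; exact: cvg_prod_mdist cvB eps0.
  exists n; split => //; apply: le_lt_trans (e_le n) _.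
  have Nn : (N <= n)%N by near: n; exact: nbhs_infty_ge.
  have qn : q ^+ n <= q ^+ N by rewrite ler_wiXn2l// ltW.
  have : q ^+ n < eps / (t + 1) by exact: le_lt_trans hN.
  rewrite ltr_pdivlMr; last by lra.
  have := exprn_gt0 n q0; nra.
have pp' : p' = p.
  apply/esym/mdist_positivity/eqP; rewrite eq_le mdist_ge0 andbT.
  apply/ler_addgt0Pl => eps eps0; rewrite addr0.
  have [|n [h1 h2 _ _ _]] := approx (eps / 2); first by rewrite divr_gt0.
  have := metric_triangle p (x n) p'; rewrite [mdist (x n) p']metric_sym; lra.
exists p, zp, wp; split => //; first by rewrite -pp'.
  apply/esym/mdist_positivity/eqP; rewrite eq_le mdist_ge0 andbT.
  apply/ler_addgt0Pl => eps eps0; rewrite addr0.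
  have [|n [_ _ h1 h2 h3]] := approx (eps / 3); first by rewrite divr_gt0.
  have := metric_triangle y (z n + w n) (zp + wp).
  have := metric_triangle (z n + w n) (zp + w n) (zp + wp).
  rewrite mdistDl// Y_inv [mdist (z n) _]metric_sym [mdist (w n) _]metric_sym.
  rewrite /e in h3; lra.
apply/ler_addgt0Pl => eps eps0; have [n [h1 _ _ _ _]] := approx _ eps0.
have [_ _ bx _] := fI n; have := metric_triangle x0 (x n) p.
rewrite [mdist (x n) p]metric_sym.
have := mulr_ge0 (ltW K0) (mdist_ge0 y (z n + w n)); rewrite /e in bx; lra.
Unshelve. all: by end_near. Qed.

(** * Distance estimates and near-minimizers *)

Lemma dist_lt_witness (R : realType) (T : metricType R) (x : T) (A : set T)
    (s : R) : (dist x A < s%:E)%E -> exists2 u, A u & mdist x u < s.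
Proof. by move=> /ereal_inf_lt [_ [u Au <-]]; rewrite lte_fin; exists u. Qed.

Lemma dist_le_mul (R : realType) (X Y : metricType R) (x : X) (A : set X)
    (y : Y) (B : set Y) (K : R) : 0 < K ->
  (forall v, B v -> exists2 p, A p & mdist x p <= K * mdist y v) ->
  (dist x A <= K%:E * dist y B)%E.
Proof.
move=> K0 h; rewrite -lee_pdivrMl//; apply: le_ereal_inf_tmp => _ [v Bv <-].
rewrite lee_pdivrMl//; have [p Ap px] := h v Bv.
by apply: ge_ereal_inf; exists (mdist x p)%:E; [exists p|rewrite lee_fin].
Qed.

(* For [t = 0] the infimum defining [dist x A] need not be attained, hence the
   hypothesis that [x] itself is then a witness. *)
Lemma dist_le_witness (R : realType) (T : metricType R) (x : T) (A : set T)
    (k k' t : R) : k < k' -> 0 <= t -> (t = 0 -> A x) ->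
  (dist x A <= (k * t)%:E)%E -> exists2 u, A u & mdist x u <= k' * t.
Proof.
move=> kk'; rewrite le_eqVlt => /predU1P[<- /(_ erefl) Ax _|t0 _ xA].
  by exists x; rewrite // mdistxx mulr0.
have [u Au /ltW xu] : exists2 u, A u & mdist x u < k' * t.
  by apply: dist_lt_witness; apply: le_lt_trans xA _; rewrite lte_fin ltr_pM2r.
by exists u.
Qed.

Theorem theorem3p1 (R : realType) (X : metricType R) (Y : linearMetricType R)
  (Y_inv : translation_invariant Y)
  (a b r kappa khat l : R)
  (a_gt0 : 0 < a) (b_gt0 : 0 < b) (r_gt0 : 0 < r)
  (kappa_gt0 : 0 < kappa) (khat_gt0 : 0 < khat) (l_gt0 : 0 < l)
  (kappal_lt1 : kappa * l < 1) (khat_gt : kappa / (1 - kappa * l) < khat)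
  (c : \bar R) (c_ge0 : (0 <= c)%E)
  (xbar : X) (zbar wbar : Y) (F G : X -> set Y)
  (Fz : F xbar zbar) (Gw : G xbar wbar) :
  let alpha : R := a + khat * (b + r) in
  let beta : \bar R := (c + (alpha * l)%:E)%E in
  let delta : \bar R := (beta + b%:E + r%:E)%E in
  complete_subset (gph F `&` (cball xbar alpha%:E `*` cball zbar delta)) ->
  complete_subset (gph G `&` (cball xbar alpha%:E `*` cball wbar beta)) ->
  restrictedly_regular F (cball zbar delta)
    (oball xbar alpha%:E `*` oball zbar delta) kappa ->
  aubin_property G (oball xbar alpha%:E) (oball wbar beta) l ->
  (forall x v, oball xbar a%:E x ->
     (sv_add F G x `&` cball (zbar + wbar) (b + r)%:E) v ->
     exists2 w, (G x `&` oball wbar ((a * l)%:E + c)%E) w &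
                set_add (F x) [set w] v) ->
  forall qbar, cball wbar (Num.min r b)%:E qbar ->
    restrictedly_regular (sv_add F G) (cball (zbar + qbar) r%:E)
      (oball xbar a%:E `*` oball (zbar + qbar) b%:E) khat.
Proof.
move=> alpha beta delta cF cG regF aubG hiii qbar.
rewrite /cball /= lee_fin le_min => /andP[qr qb] x y [] /=.
rewrite /oball /= !lte_fin => xa yb.
apply: dist_le_mul => // v [vFG]; rewrite /cball /= lee_fin => vr.
(* The minimum of [r] and [b] enters here: [mdist wbar qbar <= b] is paired with [v], within [r] of
   [zbar + qbar], and [mdist wbar qbar <= r] with [y], within [b] of it. Both sums are at most
   [b + r]. *)
have zw_le u w : mdist (zbar + w) u <= mdist wbar w + mdist wbar qbar
    + mdist (zbar + qbar) u.
  have := metric_triangle (zbar + w) (zbar + qbar) u; rewrite mdistDl//.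
  have := metric_triangle w wbar qbar; rewrite [mdist w wbar]metric_sym; lra.
have [|w0 [Gw0 w0a] [z0 Fz0 [_ -> v_eq]]] := hiii x v xa.
  split => //; rewrite /cball /= lee_fin; have := zw_le v wbar.
  by rewrite mdistxx; lra.
rewrite /oball /= in w0a.
pose t := mdist y v.
have t_lt : t < b + r.
  have := metric_triangle y (zbar + qbar) v.
  by rewrite [mdist y (_ + qbar)]metric_sym /t; lra.
(* Start and drift add up to less than [a * l + c + l * khat * (b + r)], which is [beta]. *)
have wbeta w : mdist w0 w <= l * khat * t -> ((mdist wbar w)%:E < beta)%E.
  move=> ww0; move: c_ge0 w0a; rewrite /beta.
  case: (c) => [c'| |]//= _; last by move=> _; rewrite ltry.
  rewrite -!EFinD !lte_fin => w0a; have := metric_triangle wbar w0 w.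
  have := ltr_pM2l (mulr_gt0 l_gt0 khat_gt0) t (b + r); rewrite t_lt /alpha.
  lra.
have wdelta w u : ((mdist wbar w)%:E < beta)%E ->
    mdist wbar qbar + mdist (zbar + qbar) u <= b + r ->
  ((mdist zbar (u - w))%:E < delta)%E.
  rewrite /delta mdistBr// => wb ub; have := zw_le u w; move: wb.
  case: (beta) => [b'| |]//=; last by move=> *; rewrite ltry.
  by rewrite -!EFinD !lte_fin; lra.
pose k := khat / (1 + l * khat).
have den0 : 0 < 1 + l * khat by rewrite addr_gt0 ?mulr_gt0.
have k0 : 0 < k by rewrite divr_gt0.
(* Cleared of denominators, this and [khat_gt] both read [kappa + kappa * l * khat < khat]. *)
have kk : kappa < k.
  rewrite /k ltr_pdivlMr//; move: khat_gt; rewrite ltr_pdivrMr ?subr_gt0//; lra.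
have kK : k + l * k * khat = khat by rewrite /k; field; rewrite gt_eqF.
have z0_eq : z0 = v - w0 by rewrite -v_eq addrK.
have w0b : ((mdist wbar w0)%:E < beta)%E.
  by apply: wbeta; rewrite mdistxx !mulr_ge0 ?mdist_ge0// ltW.
have xbar_le x' : mdist x x' <= khat * t -> mdist xbar x' < alpha.
  move=> xx'; have := metric_triangle xbar x x'.
  have := ltr_pM2l khat_gt0 t (b + r); rewrite t_lt /alpha; lra.
have t_ge0 : 0 <= t by exact: mdist_ge0.
have xx0 : mdist x x <= khat * t by rewrite mdistxx mulr_ge0// ltW.
(* Strict bounds place the points to which regularity and the Aubin property are applied in the open
   balls, while completeness uses the closed ones. *)
have [|||p [z [w [[Fpz _] [Gpw _] zw xp]]]] :=
  coupled_iteration Y_inv k0 l_gt0 khat_gt0 kK cF cG (x0 := x) (y := y)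
    (z0 := z0) (w0 := w0).
- split => //; split; rewrite /cball /= ?lee_fin ltW//; first exact: xbar_le.
  by rewrite z0_eq; apply: wdelta => //; lra.
- by split => //; split; rewrite /cball /= ?lee_fin ltW// xbar_le.
- rewrite v_eq -/t => x1 z1 w [Fz1 [_ z1d]] [Gw1 [_ wb]] xK wK.
  pose e := mdist y (z1 + w).
  have e_ge0 : 0 <= e by exact: mdist_ge0.
  have x1a : mdist xbar x1 < alpha.
    by apply: xbar_le; have := mulr_ge0 (ltW khat_gt0) e_ge0; rewrite /e; lra.
  have w1b : ((mdist wbar w)%:E < beta)%E.
    apply: wbeta; have := mulr_ge0 (mulr_ge0 (ltW l_gt0) (ltW khat_gt0)) e_ge0.
    by rewrite /e; lra.
  have yw : ((mdist zbar (y - w))%:E < delta)%E.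
    by apply: wdelta => //; lra.
  have yw_z : mdist (y - w) z1 = e by rewrite metric_sym mdistBr// metric_sym.
  have [||x2 Fx2 x12] :=
    @dist_le_witness _ _ x1 (sv_inv F (y - w)) _ _ _ kk e_ge0.
  - by move=> e0; rewrite /sv_inv /= (mdist_positivity _ _ (etrans yw_z e0)).
  - apply: le_trans (regF x1 (y - w) _) _.
      by split; rewrite /oball //= lte_fin.
    (* The current [z1] lies in [F x1] and in the closed [delta]-ball, so the restricted distance is
       at most the residual [e]. *)
    rewrite EFinM lee_pmul2l ?lte_fin//; apply: ge_ereal_inf.
    by exists (mdist (y - w) z1)%:E; [exists z1; first by split|rewrite yw_z].
  have ke : k * e <= khat * e.
    rewrite ler_wpM2r// -kK lerDl.
    exact: ltW (mulr_gt0 (mulr_gt0 l_gt0 k0) khat_gt0).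
  (* The budget [xK] reserves [khat * e], enough for this step of length at most [k * e]. *)
  have xx2 : mdist x x2 <= khat * t.
    have := metric_triangle x x1 x2; move: xK; rewrite -/e; lra.
  have x2a := xbar_le _ xx2.
  have [|||w2 Gw2 [d d_le w_eq]] := aubG x1 x2 _ _ w;
    rewrite /oball /= ?lte_fin//.
  have ww2 : mdist w w2 <= l * mdist x1 x2.
    move: d_le; rewrite /cball /= lee_fin; apply: le_trans.
    by rewrite -w_eq -{2}[w2]addr0 mdistDl// metric_sym.
  exists x2, w2; split => //.
  - by split => //; split; rewrite /cball /= ?lee_fin ltW.
  - split => //; split; rewrite /cball /= ?lee_fin ltW//; apply: wbeta.
    have := metric_triangle w0 w w2; move: wK; rewrite -/e.
    have := ler_wpM2l (ltW l_gt0) (le_trans x12 ke); lra.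
- by exists p; [exists z; [|exists w]|rewrite v_eq in xp].
Qed.
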